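(* Let $(X,\mu)$ be a measure space and let $\mathcal{S}\subseteq L^1(X,d\mu)\cap L^2(X,d\mu)$ be a linear subspace that is dense in the $L^2$ norm. Let $\{\phi_n\}\subseteq\mathcal{S}$ be a (countable) orthonormal basis for $L^2(X,d\mu)$ such that for some real numbers $\{\theta_n\}\subseteq\mathbb{R}$ one has $\overline{\phi_n(x)}=e^{i\theta_n}\phi_n(x)$ for all $n$. Let $T:\mathcal{S}\to L^2(X,d\mu)$ be an integral transform on $\mathcal{S}$. Suppose that $T\phi_n=\lambda_n\phi_n$ with $|\lambda_n|=1$ for all $n$, and that $T$ satisfies the Fubini property on $\mathcal{S}$: for all $f,g\in\mathcal{S}$, $$\int_X Tf(x)\,g(x)\,d\mu(x)=\int_X f(x)\,Tg(x)\,d\mu(x).$$ Then $T$ is norm-preserving on $\mathcal{S}$ as an integral transform, i.e. $\|Tf\|_{L^2(X,d\mu)}=\|f\|_{L^2(X,d\mu)}$ for all $f\in\mathcal{S}$, and $T$ extends to a unitary operator on $L^2(X,d\mu)$.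
   Context: Functions are complex valued. An integral transform on $\mathcal{S}$ is a linear map of the form $Tf(x)=\int_X K(x,y)f(y)\,d\mu(y)$, $f\in\mathcal{S}$, for some kernel $K$ for which these integrals are defined. *)

(* Defs.v *)
From HB Require Import structures.
From mathcomp Require Import all_boot all_order all_algebra.
From mathcomp Require Import all_classical all_reals all_analysis.
From mathcomp Require Import complex.
Set Implicit Arguments.
Unset Strict Implicit.
Unset Printing Implicit Defensive.
Import Order.TTheory GRing.Theory Num.Theory.
Import numFieldNormedType.Exports.
Local Open Scope classical_set_scope.
Local Open Scope ring_scope.
Local Open Scope complex_scope.

(* Elements of L^p are represented by honest functions X -> R[i]; identities
   between elements of L^p are stated almost everywhere, so that [mem_Lp] is
   the setoid whose quotient by a.e. equality is the space of classes. *)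

Section ComplexLp.
Context d (X : measurableType d) (R : realType) (mu : {measure set X -> \bar R}).

Definition cmeasurable (f : X -> R[i]) : Prop :=
  measurable_fun [set: X] (fun x => complex.Re (f x)) /\
  measurable_fun [set: X] (fun x => complex.Im (f x)).

Definition cintegrable (f : X -> R[i]) : Prop :=
  mu.-integrable [set: X] (fun x => (complex.Re (f x))%:E) /\
  mu.-integrable [set: X] (fun x => (complex.Im (f x))%:E).

(* Only meaningful when [cintegrable f] holds. *)
Definition cintegral (f : X -> R[i]) : R[i] :=
  (\int[mu]_x complex.Re (f x)) +i* (\int[mu]_x complex.Im (f x)).

Definition mem_Lp (p : \bar R) (f : X -> R[i]) : Prop :=
  cmeasurable f /\ finite_norm mu p (fun x => ComplexField.Normc.normc (f x)).

Definition L2norm (f : X -> R[i]) : \bar R :=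
  Lnorm mu 2%:E (fun x => (ComplexField.Normc.normc (f x))%:E).

Definition L2inner (f g : X -> R[i]) : R[i] :=
  cintegral (fun x => f x * (g x)^*).

Definition linear_subspace (S : set (X -> R[i])) : Prop :=
  S (fun=> 0) /\
  forall (a : R[i]) f g, S f -> S g -> S (fun x => a * f x + g x).

Definition L2dense (S : set (X -> R[i])) : Prop :=
  forall f, mem_Lp 2%:E f -> forall e : R, 0 < e ->
  exists2 g, S g & (L2norm (fun x => f x - g x)%R < e%:E)%E.

Definition L2span (I : Type) (phi : I -> X -> R[i]) : set (X -> R[i]) :=
  [set f | exists (s : seq I) (c : I -> R[i]),
    f = fun x => \sum_(n <- s) c n * phi n x].

Definition orthonormal_basis (I : eqType) (phi : I -> X -> R[i]) : Prop :=
  [/\ forall n, mem_Lp 2%:E (phi n),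
      forall m n, L2inner (phi m) (phi n) = (m == n)%:R
    & L2dense (L2span phi)].

Definition ae_linear_on (S : set (X -> R[i]))
    (T : (X -> R[i]) -> X -> R[i]) : Prop :=
  forall (a : R[i]) f g, S f -> S g ->
  {ae mu, forall x, T (fun y => a * f y + g y) x = a * T f x + T g x}.

Definition integral_transform (S : set (X -> R[i]))
    (T : (X -> R[i]) -> X -> R[i]) : Prop :=
  ae_linear_on S T /\
  exists K : X -> X -> R[i], forall f, S f ->
  {ae mu, forall x, cintegrable (fun y => K x y * f y) /\
                    T f x = cintegral (fun y => K x y * f y)}.

Definition fubini_property (S : set (X -> R[i]))
    (T : (X -> R[i]) -> X -> R[i]) : Prop :=
  forall f g, S f -> S g ->
  cintegral (fun x => T f x * g x) = cintegral (fun x => f x * T g x).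

(* The first two clauses say that [U] induces a map on the classes. *)
Record L2unitary (U : (X -> R[i]) -> X -> R[i]) : Prop := {
  L2unitary_mem : forall f, mem_Lp 2%:E f -> mem_Lp 2%:E (U f);
  L2unitary_ae : forall f g, mem_Lp 2%:E f -> mem_Lp 2%:E g ->
    {ae mu, forall x, f x = g x} -> {ae mu, forall x, U f x = U g x};
  L2unitary_linear : ae_linear_on (mem_Lp 2%:E) U;
  L2unitary_inner : forall f g, mem_Lp 2%:E f -> mem_Lp 2%:E g ->
    L2inner (U f) (U g) = L2inner f g;
  L2unitary_surj : forall g, mem_Lp 2%:E g ->
    exists2 f, mem_Lp 2%:E f & {ae mu, forall x, U f x = g x}
}.

End ComplexLp.

Definition expi (R : realType) (t : R) : R[i] := cos t +i* sin t.

(* Main.v *)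
Require Import Defs.
From HB Require Import structures.
From mathcomp Require Import all_boot all_order all_algebra.
From mathcomp Require Import all_classical all_reals all_analysis.
From mathcomp Require Import complex.
From mathcomp Require Import measurable_realfun ring lra.
Set Implicit Arguments.
Unset Strict Implicit.
Unset Printing Implicit Defensive.
Import Order.TTheory GRing.Theory Num.Theory.
Import numFieldNormedType.Exports.
Local Open Scope classical_set_scope.
Local Open Scope ring_scope.
Local Open Scope complex_scope.

(** The Fubini property and the reality condition on [phi n] give
    [<T f, phi n> = lambda n * <f, phi n>] for [f] in [S]:  both sides are
    [expi (theta n)] times integrals against [phi n] itself, and [T] can be moved
    onto [phi n].  As [`|lambda n| = 1], Parseval shows that [T] is isometric on
    [S].  The extension [U f] is the element of L^2 whose coefficients are
    [lambda n * <f, phi n>]; it exists by completeness of L^2, and it is onto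
    because the conjugate multiplier inverts it. *)

(** * Real and imaginary parts, and the squared modulus *)

Section ComplexL2.
Context d (X : measurableType d) (R : realType) (mu : {measure set X -> \bar R}).
Implicit Types (f g h : X -> R[i]) (a : R[i]).

Local Notation Re := complex.Re.
Local Notation Im := complex.Im.

Lemma conjcE a : Num.conj a = Re a -i* Im a.
Proof. by case: a. Qed.

Lemma Re_add a (b : R[i]) : Re (a + b) = Re a + Re b.
Proof. by case: a; case: b. Qed.

Lemma Im_add a (b : R[i]) : Im (a + b) = Im a + Im b.
Proof. by case: a; case: b. Qed.

Lemma Re_mul a (b : R[i]) : Re (a * b) = Re a * Re b - Im a * Im b.
Proof. by case: a; case: b. Qed.

Lemma Im_mul a (b : R[i]) : Im (a * b) = Re a * Im b + Im a * Re b.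
Proof. by case: a; case: b. Qed.

Lemma complexRe_conj a : Re (Num.conj a) = Re a.
Proof. by case: a. Qed.

Lemma complexIm_conj a : Im (Num.conj a) = - Im a.
Proof. by case: a. Qed.

(** The squared modulus as a real polynomial in the two parts, so that [ring] and the measurability
    lemmas apply without square roots. *)
Definition sqc a : R := Re a ^+ 2 + Im a ^+ 2.

Lemma sqc_ge0 a : 0 <= sqc a.
Proof. by rewrite addr_ge0 ?sqr_ge0. Qed.

Lemma sqcE a : (sqc a)%:C = a * Num.conj a.
Proof.
apply/eqP; rewrite eq_complex Re_mul Im_mul complexRe_conj complexIm_conj /= /sqc.
by apply/andP; split; apply/eqP; ring.
Qed.

Lemma sqcM a b : sqc (a * b) = sqc a * sqc b.
Proof. by rewrite /sqc Re_mul Im_mul; ring. Qed.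

Lemma sqc_normr1 a : `|a| = 1 -> sqc a = 1.
Proof.
move=> a1; have := add_Re2_Im2 a; rewrite a1 expr1n => -[]; by [].
Qed.

Lemma sqc_eq0 a : sqc a = 0 -> a = 0.
Proof.
move=> /eqP; rewrite paddr_eq0 ?sqr_ge0// !sqrf_eq0 => /andP[/eqP r0 /eqP i0].
by apply/eqP; rewrite eq_complex r0 i0 /= !eqxx.
Qed.

Lemma sqr_normcE a : ComplexField.Normc.normc a ^+ 2 = sqc a.
Proof. by case: a => x y; rewrite /sqc /= sqr_sqrtr// addr_ge0 ?sqr_ge0. Qed.

(** * Square-integrable complex functions *)

Local Notation integ f := (mu.-integrable [set: X] (EFin \o f)).

Lemma measurable_sqc f : cmeasurable f -> measurable_fun setT (sqc \o f).
Proof. by move=> [mr mi]; apply: measurable_funD; exact: measurable_funX. Qed.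

Lemma cmeasurable_lin a f g : cmeasurable f -> cmeasurable g ->
  cmeasurable (fun x => a * f x + g x).
Proof.
move=> [fr fi] [gr gi]; split.
- under eq_fun do rewrite Re_add Re_mul.
  apply: measurable_funD => //; apply: measurable_funB => //;
  exact: measurable_funM.
- under eq_fun do rewrite Im_add Im_mul.
  apply: measurable_funD => //; apply: measurable_funD => //;
  exact: measurable_funM.
Qed.

Lemma L2normE f : L2norm mu f = ((\int[mu]_x (sqc (f x))%:E) `^ 2^-1)%E.
Proof.
rewrite /L2norm unlock; congr (_ `^ _)%E; apply: eq_integral => x _.
rewrite -sqr_normcE /= ger0_norm ?poweR_EFin ?powR_mulrn//;
  by case: (f x) => *; exact: sqrtr_ge0.
Qed.

Lemma mem_L2P f : mem_Lp mu 2%:E f <-> cmeasurable f /\ integ (sqc \o f).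
Proof.
have E : finite_norm mu 2%:E (fun x => ComplexField.Normc.normc (f x)) =
  (\int[mu]_x (sqc (f x))%:E < +oo)%E.
  rewrite /finite_norm -[X in (X < _)%E]/(L2norm mu f) L2normE.
  have : (0 <= \int[mu]_x (sqc (f x))%:E)%E.
    by apply: integral_ge0 => x _; rewrite lee_fin sqc_ge0.
  case: (\int[mu]_x _)%E => [r _|_|//]; first by rewrite poweR_EFin !ltry.
  by rewrite poweRyr// invr_neq0.
rewrite /mem_Lp; split=> -[mf]; rewrite E => h; split=> //.
  apply/integrableP; split; first by apply/measurable_EFinP; exact: measurable_sqc.
  by under eq_integral do rewrite /= ger0_norm ?sqc_ge0//.
move/integrableP: h => [_].
by under eq_integral do rewrite /= ger0_norm ?sqc_ge0//.
Qed.

Lemma integ_Z (c : R) (u : X -> R) : integ u -> integ (fun x => c * u x).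
Proof. by move=> /(integrableZl measurableT c). Qed.

Lemma integ_D (u v : X -> R) : integ u -> integ v -> integ (fun x => u x + v x).
Proof. by move=> ju /(integrableD measurableT ju). Qed.

Lemma integ_B (u v : X -> R) : integ u -> integ v -> integ (fun x => u x - v x).
Proof. by move=> ju /(integrableB measurableT ju). Qed.

(** The right side exceeds the left by [sqc (a * b - c)], as in the parallelogram identity. *)
Lemma sqc_lin_le a b (c : R[i]) : sqc (a * b + c) <= 2 * (sqc a * sqc b) + 2 * sqc c.
Proof.
rewrite -sqcM; move: (a * b) => e; rewrite /sqc Re_add Im_add -subr_ge0.
have -> : 2 * (Re e ^+ 2 + Im e ^+ 2) + 2 * (Re c ^+ 2 + Im c ^+ 2) -
  ((Re e + Re c) ^+ 2 + (Im e + Im c) ^+ 2) = (Re e - Re c) ^+ 2 + (Im e - Im c) ^+ 2.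
  by ring.
by rewrite addr_ge0 ?sqr_ge0.
Qed.

Lemma mem_L2_lin a f g : mem_Lp mu 2%:E f -> mem_Lp mu 2%:E g ->
  mem_Lp mu 2%:E (fun x => a * f x + g x).
Proof.
move=> /mem_L2P[mf jf] /mem_L2P[mg jg]; apply/mem_L2P.
have m := cmeasurable_lin a mf mg; split => //.
apply: (@le_integrable _ _ _ _ _ _ _
  (EFin \o (fun x => 2 * sqc a * sqc (f x) + 2 * sqc (g x)))) => //.
- exact/measurable_EFinP/measurable_sqc.
- move=> x _ /=; rewrite lee_fin !ger0_norm ?sqc_ge0//.
    by rewrite -mulrA sqc_lin_le.
  by rewrite addr_ge0// !mulr_ge0 ?sqc_ge0.
- by apply: integ_D; exact: integ_Z.
Qed.

Lemma mem_L2_conj f : mem_Lp mu 2%:E f -> mem_Lp mu 2%:E (fun x => Num.conj (f x)).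
Proof.
move=> /mem_L2P[[mr mi] jf]; apply/mem_L2P; split.
  split; first by under eq_fun do rewrite complexRe_conj.
  by under eq_fun do rewrite complexIm_conj; exact: measurable_funN.
move: jf; congr (mu.-integrable _ _); apply/funext => x /=.
by rewrite /sqc complexRe_conj complexIm_conj sqrrN.
Qed.

Lemma mem_L2_0 : mem_Lp mu 2%:E (fun _ => 0 : R[i]).
Proof.
apply/mem_L2P; split; first by split; exact: measurable_cst.
have -> : EFin \o (sqc \o (fun _ : X => 0)) = cst 0%E.
  by apply/funext => x; rewrite /= /sqc /= expr0n addr0.
exact: integrable0.
Qed.

Lemma mem_L2Z a f : mem_Lp mu 2%:E f -> mem_Lp mu 2%:E (fun x => a * f x).
Proof.
move=> jf; have := mem_L2_lin a jf mem_L2_0.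
by under eq_fun do rewrite addr0.
Qed.

Lemma mem_L2B f g : mem_Lp mu 2%:E f -> mem_Lp mu 2%:E g ->
  mem_Lp mu 2%:E (fun x => f x - g x).
Proof.
move=> jf jg; have := mem_L2_lin (-1) jg jf.
by under eq_fun do rewrite mulN1r addrC.
Qed.

Lemma mem_L2_sum (I : Type) (s : seq I) (F : I -> X -> R[i]) :
  (forall n, mem_Lp mu 2%:E (F n)) -> mem_Lp mu 2%:E (fun x => \sum_(n <- s) F n x).
Proof.
move=> jF; elim: s => [|n s IH].
  by under eq_fun do rewrite big_nil; exact: mem_L2_0.
have := mem_L2_lin 1 (jF n) IH; congr (mem_Lp _ _ _).
by apply/funext => x; rewrite big_cons mul1r.
Qed.

(** Both parts of the product are at most [sqc (f x) + sqc (g x)] in absolute value, and this sum is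
    integrable. *)
Lemma cintegrable_mul_conj f g : mem_Lp mu 2%:E f -> mem_Lp mu 2%:E g ->
  cintegrable mu (fun x => f x * Num.conj (g x)).
Proof.
move=> /mem_L2P[[fr fi] jf] /mem_L2P[[gr gi] jg].
have jfg : integ (fun x => sqc (f x) + sqc (g x)).
  exact: integ_D.
(* Each of the two differences is half a sum of squares, given explicitly and checked by [field]. *)
have bound (a b c e : R) : `|a * b + c * e| <= (a ^+ 2 + c ^+ 2) + (b ^+ 2 + e ^+ 2).
  rewrite ler_norml; apply/andP; split; rewrite -subr_ge0.
    have -> : a * b + c * e - - (a ^+ 2 + c ^+ 2 + (b ^+ 2 + e ^+ 2)) =
      2^-1 * ((a + b) ^+ 2 + (c + e) ^+ 2 + a ^+ 2 + b ^+ 2 + c ^+ 2 + e ^+ 2) by field.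
    by rewrite mulr_ge0 ?invr_ge0// !addr_ge0 ?sqr_ge0.
  have -> : a ^+ 2 + c ^+ 2 + (b ^+ 2 + e ^+ 2) - (a * b + c * e) =
    2^-1 * ((a - b) ^+ 2 + (c - e) ^+ 2 + a ^+ 2 + b ^+ 2 + c ^+ 2 + e ^+ 2) by field.
  by rewrite mulr_ge0 ?invr_ge0// !addr_ge0 ?sqr_ge0.
split.
- apply: le_integrable jfg => //.
    under eq_fun do rewrite Re_mul complexRe_conj complexIm_conj; apply/measurable_EFinP.
    by apply: measurable_funB; apply: measurable_funM => //; exact: measurable_funN.
  move=> x _ /=; rewrite Re_mul complexRe_conj complexIm_conj mulrN opprK lee_fin.
  rewrite [leRHS]ger0_norm ?(addr_ge0 (sqc_ge0 _) (sqc_ge0 _))//; exact: bound.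
- apply: le_integrable jfg => //.
    under eq_fun do rewrite Im_mul complexRe_conj complexIm_conj; apply/measurable_EFinP.
    by apply: measurable_funD; apply: measurable_funM => //; exact: measurable_funN.
  move=> x _ /=; rewrite Im_mul complexRe_conj complexIm_conj mulrN addrC -mulrN lee_fin.
  rewrite [leRHS]ger0_norm ?(addr_ge0 (sqc_ge0 _) (sqc_ge0 _))//.
  (* For the imaginary part, [bound] is used with the coordinates of [f x] exchanged and the sign
     moved onto [Im (g x)]. *)
  rewrite [sqc (f x)]addrC.
  have := bound (Im (f x)) (Re (g x)) (Re (f x)) (- Im (g x)).
  by rewrite sqrrN.
Qed.

Lemma cintegrable_mul f g : mem_Lp mu 2%:E f -> mem_Lp mu 2%:E g ->
  cintegrable mu (fun x => f x * g x).
Proof.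
move=> jf jg; have := cintegrable_mul_conj jf (mem_L2_conj jg).
by under eq_fun do rewrite conjCK.
Qed.

Lemma cintegrable_cmeasurable f : cintegrable mu f -> cmeasurable f.
Proof.
by move=> [/measurable_int/measurable_EFinP ? /measurable_int/measurable_EFinP ?].
Qed.

(** * Complex integrals, inner products and squared norms *)

Lemma cintegral_ae_eq f g : cmeasurable f -> cmeasurable g ->
  {ae mu, forall x, f x = g x} -> cintegral mu f = cintegral mu g.
Proof.
move=> [fr fi] [gr gi] fg; rewrite /cintegral /Rintegral.
congr (fine _ +i* fine _); apply: ae_eq_integral => //; try exact/measurable_EFinP;
by apply: filterS fg => x -> _.
Qed.

Lemma cintegral_lin a f g : cintegrable mu f -> cintegrable mu g ->
  cintegral mu (fun x => a * f x + g x) = a * cintegral mu f + cintegral mu g.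
Proof.
move=> [fr fi] [gr gi].
have zr r := integ_Z r fr; have zi r := integ_Z r fi.
apply/eqP; rewrite eq_complex Re_add Im_add Re_mul Im_mul /cintegral /=.
apply/andP; split; apply/eqP.
- under eq_Rintegral do rewrite Re_add Re_mul.
  rewrite RintegralD//; last exact: integ_B.
  by rewrite RintegralB// !RintegralZl.
- under eq_Rintegral do rewrite Im_add Im_mul.
  rewrite RintegralD//; last exact: integ_D.
  by rewrite RintegralD// !RintegralZl.
Qed.

Lemma cintegralZ a f : cintegrable mu f ->
  cintegral mu (fun x => a * f x) = a * cintegral mu f.
Proof.
move=> jf; have j0 : cintegrable mu (fun _ => 0 : R[i]) by split; exact: integrable0.
have := cintegral_lin a jf j0; under eq_fun do rewrite addr0.
suff -> : cintegral mu (fun _ => 0) = 0 :> R[i] by rewrite addr0.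
by rewrite /cintegral /= /Rintegral integral0.
Qed.

Lemma cintegral_conj f : cintegrable mu f ->
  cintegral mu (fun x => Num.conj (f x)) = Num.conj (cintegral mu f).
Proof.
move=> [fr fi]; apply/eqP; rewrite eq_complex complexRe_conj complexIm_conj /cintegral /=.
apply/andP; split; apply/eqP.
  by under eq_Rintegral do rewrite complexRe_conj.
under eq_Rintegral do rewrite complexIm_conj -mulN1r.
by rewrite RintegralZl// mulN1r.
Qed.

Lemma L2inner_linl a f g h : mem_Lp mu 2%:E f -> mem_Lp mu 2%:E g ->
  mem_Lp mu 2%:E h ->
  L2inner mu (fun x => a * f x + g x) h = a * L2inner mu f h + L2inner mu g h.
Proof.
move=> jf jg jh; rewrite /L2inner -cintegral_lin; [|exact: cintegrable_mul_conj..].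
by congr cintegral; apply/funext => x; ring.
Qed.

Lemma L2inner_conj f g : mem_Lp mu 2%:E f -> mem_Lp mu 2%:E g ->
  L2inner mu g f = Num.conj (L2inner mu f g).
Proof.
move=> jf jg; rewrite /L2inner -cintegral_conj; last exact: cintegrable_mul_conj.
by congr cintegral; apply/funext => x; rewrite rmorphM /= conjCK mulrC.
Qed.

(** Real-valued, so that [ring] and [lra] apply. An infinite integral gives the default value 0, so
    this is the squared norm only on L^2. *)
Definition sqL2norm f : R := \int[mu]_x sqc (f x).

Lemma L2innerff f : L2inner mu f f = (sqL2norm f)%:C.
Proof.
rewrite /L2inner; under eq_fun do rewrite -sqcE.
by rewrite /cintegral /= /Rintegral integral0.
Qed.

Lemma sqL2norm_ge0 f : 0 <= sqL2norm f.
Proof. by apply: Rintegral_ge0 => x _; exact: sqc_ge0. Qed.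

(** Sesquilinear expansion: the two cross terms are conjugate and add up to twice a real part. *)
Lemma sqL2norm_lin a f g : mem_Lp mu 2%:E f -> mem_Lp mu 2%:E g ->
  sqL2norm (fun x => a * f x + g x) =
  sqc a * sqL2norm f + sqL2norm g + 2 * Re (a * L2inner mu f g).
Proof.
move=> jf jg; have jl := mem_L2_lin a jf jg.
have -> (h : X -> R[i]) : sqL2norm h = Re (L2inner mu h h) by rewrite L2innerff.
rewrite L2inner_linl// (L2inner_conj jl jf) (L2inner_conj jl jg) !L2inner_linl//.
rewrite (L2inner_conj jf jg) !L2innerff.
move: (L2inner mu f g) => [p q]; case: a {jl} => a b; rewrite !conjcE /sqc /=.
by ring.
Qed.

Lemma EFin_sqL2norm f : mem_Lp mu 2%:E f -> ((sqL2norm f)%:E = \int[mu]_x (sqc (f x))%:E)%E.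
Proof. by move=> /mem_L2P[_ jf]; rewrite /sqL2norm fineK// integrable_fin_num. Qed.

Lemma L2norm_sqrt f : mem_Lp mu 2%:E f -> L2norm mu f = (Num.sqrt (sqL2norm f))%:E.
Proof. by move=> jf; rewrite L2normE -EFin_sqL2norm// poweR_EFin powR12_sqrt// sqL2norm_ge0. Qed.

Lemma sqL2norm_ae f g : cmeasurable f -> cmeasurable g ->
  {ae mu, forall x, f x = g x} -> sqL2norm f = sqL2norm g.
Proof.
move=> mf mg fg; congr fine; apply: ae_eq_integral => //;
  try exact/measurable_EFinP/measurable_sqc.
by apply: filterS fg => x -> _.
Qed.

Lemma sqL2norm_eq0 f : mem_Lp mu 2%:E f -> sqL2norm f = 0 -> {ae mu, forall x, f x = 0}.
Proof.
move=> jf f0; have /mem_L2P[mf _] := jf.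
have : (\int[mu]_x `|(sqc (f x))%:E| = 0)%E.
  under eq_integral do rewrite gee0_abs ?lee_fin ?sqc_ge0//.
  by rewrite -EFin_sqL2norm// f0.
move/ae_eq_integral_abs => h.
have /h : measurable_fun setT (fun x => (sqc (f x))%:E).
  exact/measurable_EFinP/measurable_sqc.
by move=> /(_ measurableT); apply: filterS => x /(_ I)[]; exact: sqc_eq0.
Qed.

(** The parallelogram law with the nonnegative term of [f + g] dropped; it serves as a triangle
    inequality free of square roots. *)
Lemma sqL2normB_le f g : mem_Lp mu 2%:E f -> mem_Lp mu 2%:E g ->
  sqL2norm (fun x => f x - g x) <= 2 * sqL2norm f + 2 * sqL2norm g.
Proof.
move=> jf jg; have := sqL2norm_lin (-1) jg jf; have := sqL2norm_lin 1 jg jf.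
have -> : sqL2norm (fun x => -1 * g x + f x) = sqL2norm (fun x => f x - g x).
  by congr sqL2norm; apply/funext => x; rewrite mulN1r addrC.
have := sqL2norm_ge0 (fun x => 1 * g x + f x).
move: (L2inner _ _ _) => z; rewrite mul1r mulN1r /sqc /=.
rewrite (_ : Re (- z) = - Re z); last by case: z.
by lra.
Qed.

End ComplexL2.

(** * Completeness of L^2 *)

Section Completeness.
Context d (X : measurableType d) (R : realType) (mu : {measure set X -> \bar R}).
Local Notation Re := complex.Re.
Local Notation Im := complex.Im.
Local Notation L2 := (mem_Lp mu 2%:E).
Local Notation N2 := (sqL2norm mu).

(** The terms of a convergent series are bounded, so the increments of [u] are of order [2 ^- j],
    and the telescoping series is dominated by a geometric one. *)
Lemma cvgn_of_sqr_summable (u : R^nat) :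
  (\sum_(0 <= j <oo) (4 ^+ j * (u j.+1 - u j) ^+ 2)%:E < +oo)%E -> cvgn u.
Proof.
move=> su.
have bound : exists M : R, forall j, `|u j.+1 - u j| <= geometric M 2^-1 j.
  have F0 j : 0 <= 4 ^+ j * (u j.+1 - u j) ^+ 2.
    by rewrite mulr_ge0 ?sqr_ge0 ?exprn_ge0.
  have /cvg_series_bounded [M [_ hM]] := nnseries_is_cvg F0 su.
  (* [M1] exceeds [M], and it is at least 1, so that a bound of the squares by [M1] is also one by
     [M1 ^+ 2]. *)
  pose M1 := `|M| + 1; exists M1 => j.
  have M10 : 0 <= M1 by rewrite addr_ge0.
  have := hM M1; rewrite (le_lt_trans (ler_norm M)) ?ltrDl// => /(_ isT j I) /=.
  rewrite ger0_norm// => le_M1.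
  have p2 : 0 < (2 : R) ^+ j by exact: exprn_gt0.
  rewrite /geometric /= exprVn ler_pdivlMr//.
  rewrite -(@ler_pXn2r _ 2) ?nnegrE ?mulr_ge0// ?(ltW p2)//.
  rewrite exprMn real_normK ?num_real// -exprM mulnC exprM.
  rewrite (_ : 2 ^+ 2 = 4); last by ring.
  by rewrite mulrC (le_trans le_M1)// expr2 ler_peMl// lerDr.
have [M hM] := bound.
rewrite (_ : u = fun n => u 0%N + series (telescope u) n); last first.
  by apply/funext => n; exact: eq_sum_telescope.
apply: is_cvgD; first exact: is_cvg_cst.
apply: normed_cvg; apply: (@series_le_cvg _ _ (geometric M 2^-1)) => //.
  by move=> n; exact: normr_ge0.
  by move=> n; apply: le_trans (hM n); exact: normr_ge0.
by apply: is_cvg_geometric_series; rewrite ger0_norm ?invf_lt1// ltr1n.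
Qed.

(** Sum and integral commute for nonnegative terms, so the series of weighted squared increments has
    finite integral. It is then finite at almost every point, where the preceding lemma applies. *)
Lemma cvgn_ae_of_integral_sqr (u : nat -> X -> R) (C : R) :
  (forall j, measurable_fun setT (u j)) -> 0 <= C ->
  (forall j, \int[mu]_x ((u j.+1 x - u j x) ^+ 2)%:E <= (C / 8 ^+ j)%:E)%E ->
  {ae mu, forall x, cvgn (u ^~ x)}.
Proof.
move=> mU C0 hu.
pose F j x := (4 ^+ j * (u j.+1 x - u j x) ^+ 2)%:E.
have F0 j x : (0 <= F j x)%E by rewrite lee_fin mulr_ge0 ?sqr_ge0 ?exprn_ge0.
have md j : measurable_fun setT (fun x => (u j.+1 x - u j x) ^+ 2).
  by apply: measurable_funX; exact: measurable_funB.
have mF j : measurable_fun setT (F j).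
  by apply/measurable_EFinP; exact: measurable_funM.
have sF : (\int[mu]_x (\sum_(0 <= j <oo) F j x) < +oo)%E.
  rewrite integral_nneseries//.
  (* The terms equal [C / 2 ^ j], which is what the weight [4 ^ j] leaves of [C / 8 ^ j];
     [epsilon_trick] on the zero sequence sums them. *)
  have eps : (\sum_(0 <= j <oo) (2 * C / (2 ^ j.+1)%:R)%:E <= (2 * C)%:E)%E.
    have := @epsilon_trick R (fun=> 0%E) (2 * C) xpredT (fun=> lexx _).
    rewrite [X in (_ <= X + _)%E]eseries0// add0e.
    under eq_eseriesr do rewrite add0e.
    by apply; rewrite mulr_ge0.
  apply: le_lt_trans (le_trans _ eps) (ltry _).
  apply: lee_nneseries => [j _ _|j _]; first exact: integral_ge0.
  rewrite /F; under eq_integral do rewrite EFinM.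
  rewrite ge0_integralZl//; last 2 first.
  - exact/measurable_EFinP.
  - by move=> x _; rewrite lee_fin sqr_ge0.
  apply: (@le_trans _ _ ((4 ^+ j)%:E * (C / 8 ^+ j)%:E)%E).
    by apply: lee_wpmul2l; [rewrite lee_fin exprn_ge0|exact: hu].
  rewrite -EFinM lee_fin natrX exprS (_ : 8 = 2 * 4 :> R); last by ring.
  rewrite exprMn le_eqVlt; apply/orP; left; apply/eqP; field.
  by rewrite !expf_neq0//.
have mS : measurable_fun setT (fun x => \sum_(0 <= j <oo) F j x)%E.
  by apply: (@ge0_emeasurable_sum _ _ _ _ _ xpredT) => // *; exact: F0.
have : mu.-integrable setT (fun x => \sum_(0 <= j <oo) F j x)%E.
  apply/integrableP; split => //.
  by under eq_integral do rewrite gee0_abs ?nneseries_ge0//.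
move=> /integrable_ae => /(_ measurableT); apply: filterS => x /(_ I) fx.
by apply: cvgn_of_sqr_summable; rewrite -[X in (X < _)%E]fineK ?ltry.
Qed.

(** Meant for the lower limit in Fatou's lemma: a Cauchy bound holds only from the index [j] on. *)
Lemma limn_einf_le_cst (u : (\bar R)^nat) (c : \bar R) j :
  (forall m, (j <= m)%N -> (u m <= c)%E) -> (limn_einf u <= c)%E.
Proof.
move=> uc; rewrite limn_einf_lim; apply: lime_le; first exact: is_cvg_einfs.
(* The index [maxn n j] lies both in the tail starting at [n] and in the range of the bound. *)
apply: nearW => n; apply: le_trans (uc (maxn n j) (leq_maxr _ _)).
by apply: ereal_inf_lbound; exists (maxn n j) => //=; exact: leq_maxl.
Qed.

Lemma limn_einf_ge0 (u : (\bar R)^nat) :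
  (forall m, (0 <= u m)%E) -> (0 <= limn_einf u)%E.
Proof.
move=> u0; rewrite limn_einf_lim; apply: lime_ge; first exact: is_cvg_einfs.
by apply: nearW => n; apply: le_ereal_inf_tmp => _ [m _ <-].
Qed.

Lemma measurable_fun_limn_einf (f : nat -> X -> \bar R) :
  (forall n, measurable_fun setT (f n)) ->
  measurable_fun setT (fun x => limn_einf (f ^~ x)).
Proof.
move=> mf; rewrite (_ : (fun _ => _) = -%E \o (fun x => limn_esup (-%E \o f ^~ x))).
  apply: measurableT_comp => //; apply: measurable_fun_limn_esup => n.
  exact: measurableT_comp.
by apply/funext => x /=; rewrite limn_esupN oppeK.
Qed.

(* The limsup is a measurable function defined everywhere, and it agrees with
   the pointwise limit wherever that limit exists. *)
Definition esup_fun (u : nat -> X -> R) x : R := fine (limn_esup (fun n => (u n x)%:E)).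

Lemma measurable_esup_fun u : (forall n, measurable_fun setT (u n)) ->
  measurable_fun setT (esup_fun u).
Proof.
move=> mU; apply: measurableT_comp => //; apply: measurable_fun_limn_esup => n.
exact/measurable_EFinP.
Qed.

Lemma cvg_esup_fun u x : cvgn (u ^~ x) -> u ^~ x @ \oo --> esup_fun u x.
Proof.
move=> /cvg_ex[l ul]; have /cvg_limn_einf_sup[_ e] : (u n x)%:E @[n --> \oo] --> l%:E.
  exact: cvg_comp ul _.
by rewrite /esup_fun e.
Qed.

(* The rate [C / 8 ^+ j] makes [\sum_j 4 ^+ j * (h j.+1 - h j) ^+ 2] integrable,
   hence finite almost everywhere, so [h] converges almost everywhere; Fatou's
   lemma then bounds the distance to the limit. *)
Lemma riesz_fischer (h : nat -> X -> R[i]) (C : R) : 0 <= C ->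
  (forall j, L2 (h j)) ->
  (forall j m, (j <= m)%N -> N2 (fun x => h m x - h j x) <= C / 8 ^+ j) ->
  exists2 g, L2 g & forall j, N2 (fun x => g x - h j x) <= C / 8 ^+ j.
Proof.
move=> C0 jh hh.
have mh j : cmeasurable (h j) by case/mem_L2P: (jh j).
(* [p] stands for [Re] or [Im]: it respects differences and is dominated by the modulus, so its
   increments inherit the bound on [N2]. *)
have ae_cvg (p : R[i] -> R) : (forall a b, p (a - b) = p a - p b) ->
    (forall a, p a ^+ 2 <= sqc a) -> (forall j, measurable_fun setT (fun x => p (h j x))) ->
    {ae mu, forall x, cvgn (fun n => p (h n x))}.
  move=> pB ple mp; apply: cvgn_ae_of_integral_sqr C0 _ => //= j.
  have jd := mem_L2B (jh j.+1) (jh j).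
  apply: (@le_trans _ _ (N2 (fun x => h j.+1 x - h j x))%:E); last first.
    by rewrite lee_fin hh.
  rewrite EFin_sqL2norm//; apply: ge0_le_integral => //=.
  - by move=> x _; rewrite lee_fin sqr_ge0.
  - by apply/measurable_EFinP/measurable_funX; exact: measurable_funB.
  - by move/mem_L2P: jd => [md _]; apply/measurable_EFinP/measurable_sqc.
  - by move=> x _; rewrite lee_fin -pB ple.
pose g x := (esup_fun (fun n x => Re (h n x)) x) +i* (esup_fun (fun n x => Im (h n x)) x).
have mg : cmeasurable g.
  by split; apply: measurable_esup_fun => n; case: (mh n).
have g_cvg : {ae mu, forall x, Re (h n x) @[n --> \oo] --> Re (g x) /\
                                Im (h n x) @[n --> \oo] --> Im (g x)}.
  have re_cvg : {ae mu, forall x, cvgn (fun n => Re (h n x))}.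
    apply: ae_cvg => [a b|a|j]; last by case: (mh j).
      by case: a => [? ?]; case: b.
    by rewrite /sqc lerDl sqr_ge0.
  have im_cvg : {ae mu, forall x, cvgn (fun n => Im (h n x))}.
    apply: ae_cvg => [a b|a|j]; last by case: (mh j).
      by case: a => [? ?]; case: b.
    by rewrite /sqc lerDr sqr_ge0.
  apply: filterS2 re_cvg im_cvg => x rx ix; split.
    exact: (cvg_esup_fun (u := fun n x => Re (h n x))).
  exact: (cvg_esup_fun (u := fun n x => Im (h n x))).
(* Membership is proved along with the bound, since [N2] alone could be the default value 0 of an
   infinite integral. *)
have jgh j : L2 (fun x => g x - h j x) /\ N2 (fun x => g x - h j x) <= C / 8 ^+ j.
  have jd m : L2 (fun x => h m x - h j x) by exact: mem_L2B.
  have md m : measurable_fun setT (fun x => (sqc (h m x - h j x))%:E).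
    by have /mem_L2P[mm _] := jd m; exact/measurable_EFinP/measurable_sqc.
  have mgh : cmeasurable (fun x => g x - h j x).
    have := cmeasurable_lin (-1) (mh j) mg; congr cmeasurable.
    by apply/funext => x; rewrite mulN1r addrC.
  have msq : measurable_fun setT (fun x => (sqc (g x - h j x))%:E).
    exact/measurable_EFinP/measurable_sqc.
  have sqc0 (a : R[i]) : (0 <= (sqc a)%:E)%E by rewrite lee_fin sqc_ge0.
  have le_gh : (\int[mu]_x (sqc (g x - h j x))%:E <= (C / 8 ^+ j)%:E)%E.
    (* Almost everywhere the squared distance from [g] to [h j] is the limit, hence the lower limit,
       of those from [h m] to [h j]. *)
    rewrite (@ge0_ae_eq_integral _ _ _ _ _ _
      (fun x => limn_einf (fun m => (sqc (h m x - h j x))%:E)))//.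
    - apply: (le_trans (fatou _ _ _ _)) => //.
      apply: (@limn_einf_le_cst _ _ j) => m jm.
      by rewrite -EFin_sqL2norm// lee_fin hh.
    - exact: measurable_fun_limn_einf.
    - by move=> x _; apply: limn_einf_ge0 => m; exact: sqc0.
    - apply: filterS g_cvg => x [rx ix] _; symmetry.
      have /cvg_limn_einf_sup[-> //] : (sqc (h m x - h j x))%:E @[m --> \oo] -->
        (sqc (g x - h j x))%:E.
      apply: cvg_EFin; first by apply: nearW => m.
      rewrite /sqc; under eq_fun do rewrite /= Re_add Im_add !expr2.
      rewrite Re_add Im_add !expr2.
      by apply: cvgD; apply: cvgM; apply: cvgD => //; exact: cvg_cst.
  have jg : L2 (fun x => g x - h j x).
    apply/mem_L2P; split => //; apply/integrableP; split => //.
    under eq_integral do rewrite /= ger0_norm ?sqc_ge0//.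
    by rewrite (le_lt_trans le_gh)// ltry.
  by split => //; rewrite -lee_fin EFin_sqL2norm.
exists g; last by move=> j; case: (jgh j).
(* [g] is the sum of [g - h 0] and [h 0], both in L^2. *)
have [j0 _] := jgh 0%N; have := mem_L2_lin 1 j0 (jh 0%N).
by congr (mem_Lp _ _ _); apply/funext => x; rewrite mul1r subrK.
Qed.

End Completeness.

(** * Coefficients with respect to an orthonormal basis *)

Section Orthonormal.
Context d (X : measurableType d) (R : realType) (mu : {measure set X -> \bar R}).
Context (I : countType) (phi : I -> X -> R[i])
  (phi_basis : orthonormal_basis mu phi).
Implicit Types (f g h : X -> R[i]).

Local Notation L2 := (mem_Lp mu 2%:E).
Local Notation N2 := (sqL2norm mu).

Definition coef f n : R[i] := L2inner mu f (phi n).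

Definition comb (s : seq I) (a : I -> R[i]) : X -> R[i] :=
  fun x => \sum_(n <- s) a n * phi n x.

Lemma comb_cons m s a x : comb (m :: s) a x = a m * phi m x + comb s a x.
Proof. by rewrite /comb big_cons. Qed.

Let phi_L2 n : L2 (phi n).
Proof. by case: phi_basis. Qed.

Let phi_orth m n : L2inner mu (phi m) (phi n) = (m == n)%:R.
Proof. by case: phi_basis. Qed.

Lemma mem_L2_comb s a : L2 (comb s a).
Proof. by apply: mem_L2_sum => n; exact: mem_L2Z. Qed.

Lemma coef_lin a f g n : L2 f -> L2 g ->
  coef (fun x => a * f x + g x) n = a * coef f n + coef g n.
Proof. by move=> jf jg; exact: L2inner_linl. Qed.

Lemma coefB f g n : L2 f -> L2 g ->
  coef (fun x => f x - g x) n = coef f n - coef g n.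
Proof.
move=> jf jg; rewrite -mulN1r addrC -coef_lin//.
by congr coef; apply/funext => x; rewrite mulN1r addrC.
Qed.

Lemma coef_comb s a n : uniq s -> coef (comb s a) n = if n \in s then a n else 0.
Proof.
elim: s => [_|m s IH /= /andP[ms us]].
  (* The zero function is written as a difference so that [coefB] yields the coefficient 0. *)
  have -> : comb [::] a = fun x => phi n x - phi n x.
    by apply/funext => x; rewrite /comb big_nil subrr.
  by rewrite coefB// subrr.
have -> : comb (m :: s) a = fun x => a m * phi m x + comb s a x.
  by apply/funext => x; rewrite comb_cons.
rewrite coef_lin//; last exact: mem_L2_comb.
rewrite IH// in_cons /coef phi_orth; have [->|] := eqVneq n m.
  by rewrite (negbTE ms) mulr1 addr0.
by rewrite mulr0 add0r.
Qed.

(** Completing the square in each coefficient. The choice [a = coef f] gives Bessel's inequality,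
    and any other choice only adds a nonnegative sum. *)
Lemma sqL2norm_sub_comb s a f : uniq s -> L2 f ->
  N2 (fun x => f x - comb s a x) =
  N2 f - \sum_(n <- s) sqc (coef f n) + \sum_(n <- s) sqc (a n - coef f n).
Proof.
elim: s f => [|m s IH] f /=.
  move=> _ jf; rewrite !big_nil subr0 addr0.
  by congr N2; apply/funext => x; rewrite /comb big_nil subr0.
move=> /andP[ms us] jf.
(* Moving the head term into [f] alters only the coefficient at [m], and [m] does not occur in
   [s]. *)
pose f1 x := - a m * phi m x + f x.
have jf1 : L2 f1 by exact: mem_L2_lin.
have -> : (fun x => f x - comb (m :: s) a x) = (fun x => f1 x - comb s a x).
  by apply/funext => x; rewrite /f1 comb_cons; ring.
have coef1 n : n \in s -> coef f1 n = coef f n.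
  move=> ns; rewrite coef_lin// /coef phi_orth.
  by rewrite (negbTE (_ : m != n)) ?mulr0 ?add0r//; apply: contraNneq ms => ->.
rewrite IH// !big_cons (eq_big_seq (fun n => sqc (coef f n))); last first.
  by move=> n /coef1 ->.
rewrite (eq_big_seq (F1 := fun n => sqc (a n - _)) (fun n => sqc (a n - coef f n))); last first.
  by move=> n /coef1 ->.
rewrite sqL2norm_lin// (L2inner_conj jf (phi_L2 m)) -/(coef f m).
have -> : N2 (phi m) = 1.
  by have := L2innerff mu (phi m); rewrite phi_orth eqxx => /(congr1 (@complex.Re R)) /= <-.
by case: (coef f m) => p q; case: (a m) => u v; rewrite conjcE /sqc /=; ring.
Qed.

Lemma sqL2norm_sub_comb_coef s f : uniq s -> L2 f ->
  N2 (fun x => f x - comb s (coef f) x) = N2 f - \sum_(n <- s) sqc (coef f n).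
Proof.
move=> us jf; rewrite sqL2norm_sub_comb// [X in _ + X]big1 ?addr0// => n _.
by rewrite subrr /sqc expr0n addr0.
Qed.

Lemma bessel s f : uniq s -> L2 f -> \sum_(n <- s) sqc (coef f n) <= N2 f.
Proof. by move=> us jf; rewrite -subr_ge0 -sqL2norm_sub_comb_coef// sqL2norm_ge0. Qed.

Lemma sqc_coef_le f n : L2 f -> sqc (coef f n) <= N2 f.
Proof. by move=> jf; have := @bessel [:: n] f isT jf; rewrite big_seq1. Qed.

(** [L2span] allows repeated indices, whereas the norm formula needs distinct ones. The occurrences
    of an index are merged, which is why [b] may differ from [a]. *)
Lemma comb_undup s a : exists b, comb s a =1 comb (undup s) b.
Proof.
elim: s => [|m s [b sb]]; first by exists a.
rewrite /=; case: ifPn => ms.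
  exists (fun n => if n == m then a m + b m else b n) => x.
  rewrite comb_cons sb /comb.
  rewrite -mem_undup in ms; rewrite !(bigD1_seq _ ms (undup_uniq s))/= eqxx.
  rewrite mulrDl addrA; congr (_ + _).
  by apply: eq_bigr => n /negbTE ->.
exists (fun n => if n == m then a m else b n) => x.
rewrite !comb_cons sb eqxx; congr (_ + _).
apply: eq_big_seq => n; rewrite mem_undup => ns.
by rewrite ifN//; apply: contraNneq ms => <-.
Qed.

(** Parseval in approximate form: density of the span gives a combination at distance less than
    [Num.sqrt e], and replacing its coefficients by those of [f] only brings it closer. *)
Lemma sqL2norm_approx f (e : R) : L2 f -> 0 < e -> exists2 s, uniq s &
  N2 f - \sum_(n <- s) sqc (coef f n) < e.
Proof.
move=> jf e0; case: phi_basis => _ _ /(_ f jf (Num.sqrt e)).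
rewrite sqrtr_gt0 => /(_ e0)[g [s [a ->]]].
have [b ab] := comb_undup s a.
rewrite [X in L2norm _ X](_ : _ = fun x => f x - comb (undup s) b x); last first.
  by apply/funext => x; rewrite -ab.
rewrite L2norm_sqrt; last by apply: mem_L2B => //; exact: mem_L2_comb.
rewrite lte_fin ltr_sqrt// sqL2norm_sub_comb ?undup_uniq// => lte.
exists (undup s); first exact: undup_uniq.
by apply: le_lt_trans lte; rewrite lerDl sumr_ge0// => n _; exact: sqc_ge0.
Qed.

(** [N2 f] is approached by finite sums of squared coefficients, and each such sum is at most [N2 g]
    by Bessel's inequality for [g]. *)
Lemma sqL2norm_coef_le f g : L2 f -> L2 g ->
  (forall n, sqc (coef f n) = sqc (coef g n)) -> N2 f <= N2 g.
Proof.
move=> jf jg fg; apply/ler_addgt0Pr => e e0.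
have [s us] := sqL2norm_approx jf e0.
rewrite (eq_bigr _ (fun n _ => fg n)) => lte.
by have := bessel us jg; lra.
Qed.

Lemma sqL2norm_coef_eq f g : L2 f -> L2 g ->
  (forall n, sqc (coef f n) = sqc (coef g n)) -> N2 f = N2 g.
Proof. by move=> jf jg fg; apply/eqP; rewrite eq_le !sqL2norm_coef_le. Qed.

Lemma coef_ae_eq f g : L2 f -> L2 g -> coef f =1 coef g ->
  {ae mu, forall x, f x = g x}.
Proof.
move=> jf jg fg; have jfg := mem_L2B jf jg.
have N0 : N2 (fun x => f x - g x) = 0.
  (* The comparison is with [f - f], whose coefficients vanish as well. *)
  rewrite (sqL2norm_coef_eq jfg (mem_L2B jf jf)).
    rewrite /sqL2norm; under eq_Rintegral do rewrite subrr /sqc expr0n addr0.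
    by rewrite /Rintegral integral0.
  by move=> n; rewrite !coefB// fg !subrr.
by apply: filterS (sqL2norm_eq0 jfg N0) => x /eqP; rewrite subr_eq0 => /eqP.
Qed.

(* The partial sums of the wanted vector are Cauchy because their differences
   have coefficients of the same modulus as those of the partial sums of [f]. *)
Lemma unimodular_multiplier (m : I -> R[i]) f : (forall n, sqc (m n) = 1) ->
  L2 f -> exists2 g, L2 g & forall n, coef g n = m n * coef f n.
Proof.
move=> m1 jf.
have p8 j : 0 < (8 : R) ^+ j by exact: exprn_gt0.
(* The tolerance [1 / 8 ^+ j] matches the rate required by [riesz_fischer]. *)
have approx j : exists s, uniq s /\ N2 (fun x => f x - comb s (coef f) x) < 1 / 8 ^+ j.
  have e0 : 0 < 1 / (8 : R) ^+ j by rewrite divr_gt0.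
  have [s us lts] := sqL2norm_approx jf e0.
  by exists s; split => //; rewrite sqL2norm_sub_comb_coef.
have [s hs] := boolp.choice approx.
have us j : uniq (s j) by case: (hs j).
have lts j : N2 (fun x => f x - comb (s j) (coef f) x) < 1 / 8 ^+ j by case: (hs j).
pose P j := comb (s j) (coef f); pose h j := comb (s j) (fun n => m n * coef f n).
have jP j : L2 (P j) by exact: mem_L2_comb.
have jh j : L2 (h j) by exact: mem_L2_comb.
have coef_h j n : coef (h j) n = m n * coef (P j) n.
  by rewrite !coef_comb//; case: ifP; rewrite ?mulr0.
have le8 j k : (j <= k)%N -> 1 / (8 : R) ^+ k <= 1 / 8 ^+ j.
  by move=> jk; rewrite !mul1r lef_pV2 ?posrE// ler_eXn2l// ltr1n.
(* The constant 4 is [2 + 2]: [sqL2normB_le] doubles the two tolerances at [j] and [k], and the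
   latter is no larger than the former. *)
have h_cauchy j k : (j <= k)%N -> N2 (fun x => h k x - h j x) <= 4 / 8 ^+ j.
  move=> jk.
  have -> : N2 (fun x => h k x - h j x) = N2 (fun x => P k x - P j x).
    apply: sqL2norm_coef_eq => [||n]; [exact: mem_L2B..|].
    by rewrite !coefB// !coef_h -mulrBr sqcM m1 mul1r.
  have -> : (fun x => P k x - P j x) = (fun x => (f x - P j x) - (f x - P k x)).
    by apply/funext => x; ring.
  apply: le_trans (sqL2normB_le _ _) _; [exact: mem_L2B..|].
  have := le8 _ _ jk; have := lts j; have := lts k; rewrite -/(P k) -/(P j).
  by rewrite (_ : 4 / 8 ^+ j = 4 * (1 / 8 ^+ j)) ?mul1r//; lra.
have C0 : 0 <= 4 :> R by [].
have [g jg hg] := riesz_fischer C0 jh h_cauchy.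
exists g => // n; apply/eqP; rewrite -subr_eq0; apply/eqP/sqc_eq0/eqP.
rewrite eq_le sqc_ge0 andbT.
(* The error splits into the coefficients of [f - P j] and [g - h j]; [sqc_lin_le] gives
   [10 = 2 * 1 + 2 * 4]. As [j] is arbitrary, the left side is 0. *)
have bound j : sqc (coef g n - m n * coef f n) <= geometric 10 8^-1 j.
  have -> : coef g n - m n * coef f n =
    - m n * coef (fun x => f x - P j x) n + coef (fun x => g x - h j x) n.
    by rewrite !coefB// coef_h; ring.
  apply: le_trans (sqc_lin_le _ _ _) _.
  have -> : sqc (- m n) = 1 by rewrite -mulN1r sqcM m1 /sqc /= oppr0 sqrrN; ring.
  have := sqc_coef_le n (mem_L2B jf (jP j)).
  have := sqc_coef_le n (mem_L2B jg (jh j)).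
  have := lts j; have := hg j; rewrite /geometric /= exprVn -/(P j) mul1r.
  by lra.
have cvg0 : geometric (10 : R) 8^-1 @ \oo --> 0.
  by apply: cvg_geometric; rewrite ger0_norm ?invf_lt1// ltr1n.
have <- : limn (geometric (10 : R) 8^-1) = 0 by exact/cvg_lim.
by apply: limr_ge; [exact: cvgP cvg0|exact: nearW].
Qed.

End Orthonormal.

(** * Isometry of the transform and its unitary extension *)

Theorem theorem5p2 (R : realType) (d : measure_display) (X : measurableType d)
    (mu : {measure set X -> \bar R})
    (S : set (X -> R[i]))
    (S_sub : forall f, S f -> mem_Lp mu 1%:E f /\ mem_Lp mu 2%:E f)
    (S_lin : linear_subspace S)
    (S_dense : L2dense mu S)
    (I : countType) (phi : I -> X -> R[i])
    (phi_S : forall n, S (phi n))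
    (phi_basis : orthonormal_basis mu phi)
    (theta : I -> R)
    (phi_conj : forall n,
      {ae mu, forall x, (phi n x)^* = expi (theta n) * phi n x})
    (T : (X -> R[i]) -> X -> R[i])
    (T_L2 : forall f, S f -> mem_Lp mu 2%:E (T f))
    (T_int : integral_transform mu S T)
    (lambda : I -> R[i])
    (T_eigen : forall n, {ae mu, forall x, T (phi n) x = lambda n * phi n x})
    (lambda_norm : forall n, `|lambda n| = 1)
    (T_fubini : fubini_property mu S T) :
  (forall f, S f -> L2norm mu (T f) = L2norm mu f) /\
  (exists U : (X -> R[i]) -> X -> R[i],
     L2unitary mu U /\
     forall f, S f -> {ae mu, forall x, U f x = T f x}).
Proof.
have phi_L2 n : mem_Lp mu 2%:E (phi n) by case: (S_sub _ (phi_S n)).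
have S_L2 f : S f -> mem_Lp mu 2%:E f by move=> /S_sub[].
(* Up to a constant phase, the inner product with [phi n] is the bilinear pairing that appears in
   the Fubini property. *)
have coef_conj f n : mem_Lp mu 2%:E f ->
    coef mu phi f n = expi (theta n) * cintegral mu (fun x => f x * phi n x).
  move=> jf; have jfp : cintegrable mu (fun x => f x * phi n x).
    exact: cintegrable_mul.
  rewrite -cintegralZ//; apply: cintegral_ae_eq.
  - exact: cintegrable_cmeasurable (cintegrable_mul_conj jf (phi_L2 n)).
  - have := cintegrable_cmeasurable
      (cintegrable_mul jf (mem_L2Z (expi (theta n)) (phi_L2 n))).
    by congr cmeasurable; apply/funext => x; rewrite mulrCA.
  - apply: filterS (phi_conj n) => x phix.
    by rewrite mulrCA -phix.
have coef_T f n : S f -> coef mu phi (T f) n = lambda n * coef mu phi f n.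
  move=> Sf; have jf := S_L2 f Sf; have jTf := T_L2 _ Sf.
  rewrite !coef_conj// T_fubini// [RHS]mulrCA; congr (_ * _).
  rewrite -cintegralZ; last exact: cintegrable_mul.
  apply: cintegral_ae_eq.
  - exact: cintegrable_cmeasurable (cintegrable_mul jf (T_L2 _ (phi_S n))).
  - have := cintegrable_cmeasurable (cintegrable_mul jf (mem_L2Z (lambda n) (phi_L2 n))).
    by congr cmeasurable; apply/funext => x; rewrite mulrCA.
  - by apply: filterS (T_eigen n) => x ->; rewrite mulrCA.
have lambda1 n : sqc (lambda n) = 1 by exact: sqc_normr1.
have coef_sqc f g : (forall n, coef mu phi g n = lambda n * coef mu phi f n) ->
    forall n, sqc (coef mu phi g n) = sqc (coef mu phi f n).
  by move=> fg n; rewrite fg sqcM lambda1 mul1r.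
split=> [f Sf|].
  rewrite (L2norm_sqrt (T_L2 _ Sf)) (L2norm_sqrt (S_L2 _ Sf)).
  rewrite (sqL2norm_coef_eq phi_basis (T_L2 _ Sf) (S_L2 _ Sf))// => n.
  by apply: coef_sqc => k; exact: coef_T.
(* The hypothesis on [f] sits under the existential so that choice yields a total [U]; outside L^2
   nothing is required of its values. *)
have U_ex f : exists g, mem_Lp mu 2%:E f ->
    mem_Lp mu 2%:E g /\ forall n, coef mu phi g n = lambda n * coef mu phi f n.
  have [jf|] := pselect (mem_Lp mu 2%:E f); last by exists f.
  by have [g jg fg] := unimodular_multiplier phi_basis lambda1 jf; exists g.
have [U hU] := boolp.choice U_ex.
have U_L2 f : mem_Lp mu 2%:E f -> mem_Lp mu 2%:E (U f) by move=> /hU[].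
have coef_U f n : mem_Lp mu 2%:E f -> coef mu phi (U f) n = lambda n * coef mu phi f n.
  by move=> /hU[].
(* Choice picks representatives independently for each function, so linearity is obtained almost
   everywhere, by comparing coefficients. *)
have U_lin : ae_linear_on mu (mem_Lp mu 2%:E) U.
  move=> a f g jf jg; apply: (coef_ae_eq phi_basis).
  - exact/U_L2/mem_L2_lin.
  - by apply: mem_L2_lin; exact: U_L2.
  - move=> n; rewrite coef_U; last exact: mem_L2_lin.
    rewrite !coef_lin ?coef_U//; try exact: U_L2.
    by ring.
have sqL2norm_U f : mem_Lp mu 2%:E f -> sqL2norm mu (U f) = sqL2norm mu f.
  move=> jf; apply: (sqL2norm_coef_eq phi_basis) => //; first exact: U_L2.
  by apply: coef_sqc => n; exact: coef_U.
exists U; split; last first.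
  move=> f Sf; apply: (coef_ae_eq phi_basis); [exact/U_L2/S_L2|exact: T_L2|].
  by move=> n; rewrite coef_U ?coef_T//; exact: S_L2.
split => //.
- move=> f g jf jg fg; apply: (coef_ae_eq phi_basis); [exact: U_L2..|].
  move=> n; rewrite !coef_U//; congr (_ * _); apply: cintegral_ae_eq.
  + exact: cintegrable_cmeasurable (cintegrable_mul_conj jf (phi_L2 n)).
  + exact: cintegrable_cmeasurable (cintegrable_mul_conj jg (phi_L2 n)).
  + by apply: filterS fg => x ->.
- move=> f g jf jg.
  (* Polarisation: expanding the norms of [a * U f + U g] and [a * f + g], which agree, isolates the
     cross terms. *)
  have Re_eq a : complex.Re (a * L2inner mu (U f) (U g)) = complex.Re (a * L2inner mu f g).
    have jU : mem_Lp mu 2%:E (fun x => a * U f x + U g x).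
      by apply: mem_L2_lin; exact: U_L2.
    have := sqL2norm_U _ (mem_L2_lin a jf jg).
    rewrite (sqL2norm_ae _ _ (U_lin a f g jf jg)); last 2 first.
      by have /mem_L2P[] := U_L2 _ (mem_L2_lin a jf jg).
      by have /mem_L2P[] := jU.
    rewrite !sqL2norm_lin ?sqL2norm_U//; try exact: U_L2.
    by lra.
  move: (L2inner mu (U f) (U g)) (L2inner mu f g) Re_eq => [p q] [r s] Re_eq.
  (* The value 1 of [a] compares the real parts, the value [-i] the imaginary parts. *)
  have := Re_eq 1; have := Re_eq (0 +i* (-1)); rewrite !Re_mul /= => im_eq re_eq.
  by congr (_ +i* _); lra.
- move=> g jg.
  have lambdaJ n : sqc (Num.conj (lambda n)) = 1.
    by rewrite /sqc complexRe_conj complexIm_conj sqrrN; exact: lambda1.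
  have [f jf fg] := unimodular_multiplier phi_basis lambdaJ jg.
  exists f => //; apply: (coef_ae_eq phi_basis) => //; first exact: U_L2.
  move=> n; rewrite coef_U// fg mulrA -sqcE lambda1.
  by rewrite mul1r.
Qed.
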